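(* For every integer $n\ge 1$, $$\mathrm{Pnest}_n(t)=\sum_{i=1}^{\lceil n/2\rceil}\bigl[H(n,2i-1)+H(n,2i)\bigr]t^i\qquad\text{and}\qquad \mathrm{Pnest}^c_n(t)=\sum_{i=1}^{\lceil n/2\rceil}\bigl[H(n-1,2i-2)+H(n-1,2i-1)\bigr]t^i,$$ where $\mathrm{Pnest}_n(t)=\sum_{\mathbf a\in\mathcal{DP}(n)}t^{\mathrm{pnest}(\mathbf a)}$, $\mathrm{Pnest}^c_n(t)$ is the same sum restricted to those $\mathbf a\in\mathcal{DP}(n)$ for which $\Gamma_{\mathbf a}$ is connected, and $H(m,k)$ is the number of Dyck paths of semilength $m$ and height $k$.
   Context: Write $[n]=\{1,\dots,n\}$. An area sequence of size $n$ is a sequence $\mathbf a=(a_1,\dots,a_n)$ of nonnegative integers with $a_i<i$ for all $i$ and $a_i\le a_{i-1}+1$ for all $i\ge 2$; $\mathcal{DP}(n)$ is the set of all of them. Each $\mathbf a\in\mathcal{DP}(n)$ defines a graph $\Gamma_{\mathbf a}$ (a unit interval graph) on $[n]$ with edges $\{j,i\}$ for $1\le j<i\le n$ with $i-a_i\le j$. If $\{i,j\}$ with $i<j$ is an edge then $\{i,i+1,\dots,j\}$ is a clique. A peak-edge of $\Gamma_{\mathbf a}$ is either an isolated vertex $i$ (put $j=i$) or an edge $\{i,j\}$, $i<j$, such that neither $\{i,j+1\}$ nor $\{i-1,j\}$ is an edge (pairs not contained in $[n]$ are not edges). The corresponding peak-clique is $\{i,i+1,\dots,j\}$. The peak-nesting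 of a vertex is the number of peak-cliques containing it, and $\mathrm{pnest}(\mathbf a)$ is the maximum of these numbers over all vertices. A Dyck path of semilength $m$ is a lattice path from $(0,0)$ to $(2m,0)$ with steps $U=(1,1)$, $D=(1,-1)$ never going below the $x$-axis; its height is the largest $y$-coordinate attained. Conventions: $H(0,0)=1$ (the empty path has height 0), $H(m,k)=0$ if $k>m$, and $H(m,0)=0$ for $m\ge1$. *)

(* Defs.v *)
From HB Require Import structures.
From mathcomp Require Import all_boot all_order all_algebra.

Set Implicit Arguments.
Unset Strict Implicit.
Unset Printing Implicit Defensive.

Import GRing.Theory.

(* Vertices and positions are numbered from 0: i : 'I_n stands for the element *)
(* i + 1 of [n].  Hence "a_i < i" reads [a i <= i].  This forces a_i < n, so    *)
(* taking values in 'I_n loses no area sequence.                               *)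
Definition area_sequence n (a : {ffun 'I_n -> 'I_n}) : bool :=
  [forall i : 'I_n, a i <= i] &&
  [forall i : 'I_n, forall j : 'I_n, ((j : nat) == i.+1) ==> (a j <= (a i).+1)].

Definition DP n : {set {ffun 'I_n -> 'I_n}} := [set a | area_sequence a].

Definition Gamma n (a : {ffun 'I_n -> 'I_n}) : rel 'I_n :=
  fun i j => ((j < i) && (i - a i <= j)) || ((i < j) && (j - a j <= i)).

Definition graph_connected n (e : rel 'I_n) : bool :=
  [forall x : 'I_n, forall y : 'I_n, connect e x y].

Definition isolated n (e : rel 'I_n) (i : 'I_n) : bool :=
  [forall k : 'I_n, ~~ e i k].

(* The quantified forms make {i, j+1} and {i-1, j} non-edges when j+1 or i-1   *)
(* is not a vertex.                                                            *)
Definition peak_edge n (e : rel 'I_n) (i j : 'I_n) : bool :=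
  ((i == j) && isolated e i) ||
  [&& i < j, e i j,
      [forall k : 'I_n, ((k : nat) == j.+1) ==> ~~ e i k] &
      [forall k : 'I_n, (k.+1 == i) ==> ~~ e k j]].

Definition peak_cliques n (e : rel 'I_n) : {set {set 'I_n}} :=
  [set [set k : 'I_n | p.1 <= k <= p.2]
     | p : 'I_n * 'I_n & peak_edge e p.1 p.2].

Definition peak_nesting n (e : rel 'I_n) (v : 'I_n) : nat :=
  #|[set C in peak_cliques e | v \in C]|.

Definition pnest n (a : {ffun 'I_n -> 'I_n}) : nat :=
  \max_(v : 'I_n) peak_nesting (Gamma a) v.

Definition Pnest n : {poly int} := (\sum_(a in DP n) 'X^(pnest a))%R.

Definition Pnest_c n : {poly int} :=
  (\sum_(a in DP n | graph_connected (Gamma a)) 'X^(pnest a))%R.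

(* A path with 2m steps: true is the step U = (1,1), false is D = (1,-1).      *)
(* [level p k] is the y-coordinate after the first k steps.                    *)
Definition level m (p : m.*2.-tuple bool) (k : nat) : int :=
  (\sum_(b <- take k p) (if b then 1 else -1))%R.

Definition dyck_path m (p : m.*2.-tuple bool) : bool :=
  [forall k : 'I_(m.*2.+1), (0 <= level p k)%R] && (level p m.*2 == 0%R).

(* The absolute value only converts to nat: levels of a Dyck path are          *)
(* nonnegative.                                                                *)
Definition height m (p : m.*2.-tuple bool) : nat :=
  \max_(k < m.*2.+1) `|level p k|%N.

Definition H (m k : nat) : nat :=
  #|[set p : m.*2.-tuple bool | dyck_path p & height p == k]|.

(* Main.v *)
Require Import Defs.
From HB Require Import structures.
From mathcomp Require Import all_boot all_order all_algebra.
From mathcomp Require Import zify.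

Set Implicit Arguments.
Unset Strict Implicit.
Unset Printing Implicit Defensive.

Import GRing.Theory.

(* Put b_j = j - a_j. The maximal cliques are the intervals [b_j, j] where j is  *)
(* an "end", i.e. b_j < b_(j+1) or j is the last vertex; the values of b are     *)
(* the "starts". The word s_1 e_1 s_2 e_2 ... with s_v = U iff v is a start and  *)
(* e_v = D iff v is an end is a Dyck path, and every Dyck path of semilength n   *)
(* arises once, because b_j <= v iff there are fewer ends before j than starts   *)
(* up to v. The number d_v of cliques containing v is #starts up to v minus      *)
(* #ends before v, so the path is at level 2 d_v - 1 between s_v and e_v, and    *)
(* its height is 2 d - 1 or 2 d with d = max d_v. The graph is connected iff the *)
(* path returns to the axis only at its end, i.e. is U q D with q a Dyck path.   *)

(** Everything rests on one bijection, [encode] with inverse [decode], between area sequences and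
    Dyck paths, and on reading both statistics off the path. A single equivalence between left ends
    and counts drives both directions: [leq_b_cnt] proves it for the left ends of a graph,
    [leq_lend] for those rebuilt from a path, which leads to [encodeK] and [decodeK]. By
    [pnest_encode] the peak-nesting is half the height, rounded up, so heights 2i-1 and 2i share the
    exponent i; [uphalf_height_gt0] and [uphalf_height_le] bound i. By [connected_encode]
    connectedness means that the path is some U q D, and passing to q lowers semilength and height
    by one ([card_prime_height]), whence the shifted arguments of [H] in the second formula. *)

Definition cnt (P : pred nat) k := \sum_(i < k) P i.

Lemma cntS P k : cnt P k.+1 = cnt P k + P k.
Proof. exact: big_ord_recr. Qed.

Lemma cnt0 P : cnt P 0 = 0.
Proof. exact: big_ord0. Qed.

Lemma leq_cnt P i j : i <= j -> cnt P i <= cnt P j.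
Proof.
move=> /subnK <-; elim: (j - i) => // d IH.
by rewrite addSn cntS (leq_trans IH) ?leq_addr.
Qed.

Lemma cnt_subadd P i j : i <= j -> cnt P j <= cnt P i + (j - i).
Proof.
move=> ij; rewrite -{1}(subnK ij); elim: (j - i) => [|d IH]; first by rewrite addn0.
by rewrite addSn cntS; have := leq_b1 (P (d + i)); lia.
Qed.

Lemma eq_cnt (P Q : pred nat) m k :
  (forall i, i < m -> P i = Q i) -> k <= m -> cnt P k = cnt Q k.
Proof. by move=> PQ km; apply: eq_bigr => i _; rewrite PQ ?(leq_trans (ltn_ord i)). Qed.

Lemma cnt_crossing P k N :
  N < cnt P k -> exists2 j, j < k & P j /\ cnt P j = N.
Proof.
elim: k => [|k IH]; first by rewrite cnt0.
rewrite cntS; case: (ltnP N (cnt P k)) => [/IH [j jk Hj] _|le lt].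
  by exists j => //; exact: ltnW.
by exists k => //; move: lt; case: (P k) => //=; lia.
Qed.

(** [cnt P j] is the rank of a marked position j, counted from 0, so the condition selects the first
    N marked positions. *)
Lemma cnt_below (P : pred nat) N m :
  \sum_(j < m) (P j && (cnt P j < N)) = minn N (cnt P m).
Proof.
elim: m => [|m IH]; first by rewrite big_ord0 cnt0 minn0.
by rewrite big_ord_recr IH cntS /=; case: (P m) => /=; case: ltnP; lia.
Qed.

(** * Starts and ends of a monotone family of left ends *)

Section LeftEnds.

Variables (n : nat) (b : nat -> nat).
Hypotheses (b_le : forall i, b i <= i) (b_mono : forall i, b i <= b i.+1).
Hypothesis b_id : forall i, n <= i -> b i = i.

Definition startb u := u \in [seq b j | j <- iota 0 n].
Definition endb j := b j < b j.+1.

Lemma b_homo i j : i <= j -> b i <= b j.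
Proof.
move=> /subnK <-; elim: (j - i) => // d IH.
by rewrite addSn (leq_trans IH).
Qed.

Lemma startbP u : u < n -> reflect (exists j, b j = u) (startb u).
Proof.
move=> un; apply: (iffP mapP) => [[j _ ->]|[j bj]]; first by exists j.
exists j => //; rewrite mem_iota add0n; case: (ltnP j n) => //= nj.
by have := b_id nj; lia.
Qed.

(** When [b] stays put at j, neither side changes. When it jumps, j is an end, and exactly one start
    is passed: [b j] itself, since monotonicity leaves no value of [b] strictly between [b j] and
    [b j.+1]. *)
Lemma cnt_startb_b j : j <= n -> cnt startb (b j) = cnt endb j.
Proof.
elim: j => [|j IH] jn.
  by have := b_le 0; rewrite leqn0 => /eqP ->; rewrite !cnt0.
rewrite cntS -IH 1?ltnW // /endb; case: ltnP => [lt|ge]; last first.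
  by rewrite addn0; congr cnt; apply/eqP; rewrite eqn_leq ge b_mono.
have bjn : b j < n by apply: leq_ltn_trans (b_le j) jn.
have sj : startb (b j) by apply/startbP => //; exists j.
suff H d : b j + d.+1 <= b j.+1 -> cnt startb (b j + d.+1) = cnt startb (b j) + 1.
  by have := H (b j.+1 - (b j).+1); rewrite addnS -addSn subnKC //; apply.
elim: d => [|d IHd] led; first by rewrite addn1 cntS sj.
rewrite addnS cntS IHd; last by lia.
suff -> : startb (b j + d.+1) = false by rewrite addn0.
apply/negP => /startbP []; first by have := b_le j.+1; lia.
move=> i; case: (leqP i j) => [/b_homo|/b_homo]; lia.
Qed.

(* The counts of starts and ends determine [b]; [lend] below inverts this. *)
Lemma leq_b_cnt j v : j < n -> (b j <= v) = (cnt endb j < cnt startb v.+1).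
Proof.
move=> jn; rewrite -(cnt_startb_b (ltnW jn)).
have sj : startb (b j).
  by apply/startbP; [apply: leq_ltn_trans (b_le j) jn | exists j].
case: (leqP (b j) v) => bv; apply: esym.
  by apply: (leq_trans _ (leq_cnt startb (bv : (b j).+1 <= v.+1))); rewrite cntS sj addn1.
by apply: negbTE; rewrite -leqNgt; apply: leq_cnt.
Qed.

Lemma cnt_startb_endb : cnt startb n = cnt endb n.
Proof. by rewrite -cnt_startb_b // b_id. Qed.

(** By [leq_b_cnt] the ends j with [b j <= v] are the first [cnt startb v.+1] ends. Those with j < v
    are all among them, because [b j <= j], and they are the ones to discard. *)
Lemma sum_nesting v : v < n ->
  \sum_(j < n) (endb j && (b j <= v <= j)) = cnt startb v.+1 - cnt endb v.
Proof.
move=> vn.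
have : \sum_(j < n) (endb j && (b j <= v)) = cnt startb v.+1.
  transitivity (minn (cnt startb v.+1) (cnt endb n)).
    by rewrite -cnt_below; apply: eq_bigr => j _; rewrite leq_b_cnt.
  by apply/minn_idPl; rewrite -cnt_startb_endb leq_cnt.
have -> : cnt endb v = \sum_(j < n) (endb j && (j < v)).
  rewrite /cnt (big_ord_widen n (fun j => endb j : nat)) 1?ltnW // big_mkcond.
  by apply: eq_bigr => j _; case: (j < v); rewrite ?andbT ?andbF.
move=> <-.
suff -> : \sum_(j < n) (endb j && (b j <= v)) =
    \sum_(j < n) (endb j && (b j <= v <= j)) + \sum_(j < n) (endb j && (j < v)).
  by rewrite addnK.
rewrite -big_split; apply: eq_bigr => j _ /=.
case: (endb j) => //=; case: (leqP v j) => [_|jv]; first by rewrite andbT addn0.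
by rewrite (leq_trans (b_le j) (ltnW jv)).
Qed.

End LeftEnds.

(** * Left ends rebuilt from prescribed starts and ends *)

Section FromCounts.

Variables (n : nat) (S E : pred nat).
Hypothesis dominated : forall k, k < n -> cnt E k < cnt S k.+1.
Hypothesis balanced : cnt S n = cnt E n.

(** The least v that satisfies the criterion of [leq_b_cnt]. If there is none, [find] returns n,
    which is the value wanted at j = n. *)
Definition lend j := find (fun v => cnt E j < cnt S v.+1) (iota 0 n).

Lemma lend_le_n j : lend j <= n.
Proof. by rewrite -[X in _ <= X](size_iota 0) find_size. Qed.

Lemma leq_lend j v : v < n -> (lend j <= v) = (cnt E j < cnt S v.+1).
Proof.
move=> vn; apply/idP/idP => H.
  have jn : lend j < n by exact: leq_ltn_trans H vn.
  have : has (fun v => cnt E j < cnt S v.+1) (iota 0 n) by rewrite has_find size_iota.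
  move=> /(nth_find 0); rewrite nth_iota // add0n => /leq_trans; apply.
  exact: leq_cnt.
rewrite leqNgt; apply/negP => /(before_find 0).
by rewrite nth_iota // add0n H.
Qed.

Lemma lend_le j : j < n -> lend j <= j.
Proof. by move=> jn; rewrite leq_lend ?dominated. Qed.

Lemma lend_mono j : lend j <= lend j.+1.
Proof.
have := lend_le_n j.+1; rewrite leq_eqVlt => /orP[/eqP ->|lt]; first exact: lend_le_n.
rewrite leq_lend //; have := leqnn (lend j.+1); rewrite leq_lend //.
by apply: leq_ltn_trans; exact: leq_cnt.
Qed.

Lemma lend_n : lend n = n.
Proof.
apply/eqP; rewrite eqn_leq lend_le_n leqNgt; apply/negP => lt.
have := leqnn (lend n); rewrite leq_lend // -balanced ltnNge.
by rewrite leq_cnt.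
Qed.

(** The value v is taken at j iff [cnt S v <= cnt E j < cnt S v.+1], which forces [S v]. *)
Lemma lend_start v : v < n -> (v \in [seq lend j | j <- iota 0 n]) = S v.
Proof.
move=> vn; apply/mapP/idP => [[j]|Sv].
  move=> _ vj; have := leq_lend j vn; rewrite -vj leqnn => /esym lt.
  have le : cnt S v <= cnt E j.
    case: v vn vj lt => [|u] un uj lt; first by rewrite cnt0.
    by rewrite leqNgt -(leq_lend _ (ltnW un)) -uj ltnn.
  by move: lt; rewrite cntS; case: (S v) => //=; lia.
(* Conversely, by balance there is an end of the same rank as the start v; it is the required j. *)
have : cnt S v < cnt E n.
  by rewrite -balanced; apply: (leq_trans _ (leq_cnt S vn)); rewrite cntS Sv addn1.
move=> /cnt_crossing [j jn [_ Ej]]; exists j; first by rewrite mem_iota.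
apply/eqP; rewrite eqn_leq leq_lend // Ej cntS Sv addn1 leqnn andbT.
case: v vn Sv Ej => // u un Sv Ej.
by rewrite ltnNge (leq_lend _ (ltnW un)) Ej ltnn.
Qed.

(** As [lend j] is the first place where the count of starts exceeds [cnt E j], it exceeds it there
    by exactly one; one more end therefore pushes the left end further. *)
Lemma lend_end j : j < n -> (lend j < lend j.+1) = E j.
Proof.
move=> jn; have ljn : lend j < n by apply: leq_ltn_trans (lend_le jn) jn.
rewrite ltnNge leq_lend // cntS.
have := leqnn (lend j); rewrite leq_lend // => lt.
case: (E j) => /=; last by rewrite addn0 lt.
rewrite addn1 -leqNgt; case: (posnP (lend j)) lt => [->|gt0] lt.
  by rewrite cntS cnt0; case: (S 0).
have : ~~ (lend j <= (lend j).-1) by rewrite -ltnNge prednK.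
rewrite leq_lend; last by rewrite (leq_ltn_trans (leq_pred _)).
rewrite prednK // cntS -leqNgt; have := leq_b1 (S (lend j)); lia.
Qed.

End FromCounts.

(** * Levels and heights of Dyck paths in terms of counts *)

Section Paths.

Variable m : nat.
Implicit Type p : m.*2.-tuple bool.

(** Steps 2i and 2i+1 belong to vertex i: an up-step at the first marks a start, a down-step at the
    second marks an end. *)
Definition ups p i := nth false p i.*2.
Definition downs p i := ~~ nth false p i.*2.+1.

Lemma levelS p k : k < m.*2 ->
  level p k.+1 = (level p k + (if nth false p k then 1 else -1))%R.
Proof.
by move=> km; rewrite /level (take_nth false) ?size_tuple // -cats1 big_cat big_seq1.
Qed.

Lemma level_even p k : k <= m ->
  level p k.*2 = (2 * ((cnt (ups p) k)%:Z - (cnt (downs p) k)%:Z))%R.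
Proof.
elim: k => [|k IH] km; first by rewrite /level take0 big_nil !cnt0.
rewrite doubleS !levelS; try lia.
rewrite (IH (ltnW km)) !cntS /ups /downs.
by case: (nth _ _ _); case: (nth _ _ _) => /=; lia.
Qed.

Lemma level_odd p k : k < m ->
  level p k.*2.+1 = (2 * ((cnt (ups p) k.+1)%:Z - (cnt (downs p) k)%:Z) - 1)%R.
Proof.
move=> km; rewrite levelS; last by lia.
by rewrite (level_even _ (ltnW km)) cntS /ups; case: (nth _ _ _) => /=; lia.
Qed.

Lemma cnt_ups_downs p k :
  (forall i, i < m -> cnt (downs p) i < cnt (ups p) i.+1) ->
  k <= m -> cnt (downs p) k <= cnt (ups p) k.
Proof.
case: k => [|k] dom km; first by rewrite !cnt0.
by have := dom k km; rewrite (cntS (downs p)); have := leq_b1 (downs p k); lia.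
Qed.

(** Odd-time levels have the form 2x-1, so they are nonnegative iff x > 0; they are then at least 1,
    which keeps the neighbouring even-time levels nonnegative. *)
Lemma dyck_pathP p : reflect
  ((forall k, k < m -> cnt (downs p) k < cnt (ups p) k.+1) /\
    cnt (ups p) m = cnt (downs p) m)
  (dyck_path p).
Proof.
apply: (iffP andP) => [[/forallP pos /eqP bal]|[dom bal]]; split.
- move=> k km; have lt : k.*2.+1 < m.*2.+1 by lia.
  by have := pos (Ordinal lt); rewrite level_odd //=; lia.
- by move: bal; rewrite level_even //; lia.
- apply/forallP => -[k km] /=; have kE := odd_double_half k.
  have le : k./2 <= m by lia.
  rewrite -kE; case: (odd k) kE => kE /=.
    rewrite add1n level_odd; last by lia.
    have /dom : k./2 < m by lia.
    by lia.
  by rewrite add0n level_even //; have := cnt_ups_downs dom le; lia.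
- by rewrite level_even // bal subrr mulr0.
Qed.

(** With M the maximum, the highest odd-time level is 2M-1 and even-time levels are at most 2M. *)
Lemma uphalf_height p : dyck_path p ->
  uphalf (height p) = \max_(k < m) (cnt (ups p) k.+1 - cnt (downs p) k).
Proof.
move=> /dyck_pathP[dom bal]; apply/eqP; rewrite eqn_leq; apply/andP; split.
  set M := \max_(k < m) _.
  have leM k : k < m -> cnt (ups p) k.+1 - cnt (downs p) k <= M.
    move=> km; exact: (leq_bigmax (F := fun k : 'I_m =>
      cnt (ups p) k.+1 - cnt (downs p) k) (Ordinal km)).
  suff : height p <= M.*2 by lia.
  apply/bigmax_leqP => -[k km] _ /=; have kE := odd_double_half k.
  have le : k./2 <= m by lia.
  rewrite -kE; case: (odd k) kE => kE /=.
    have lt : k./2 < m by lia.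
    by rewrite add1n level_odd //; have := dom _ lt; have := leM _ lt; lia.
  rewrite add0n level_even //; have ge := cnt_ups_downs dom le.
  move: le; rewrite leq_eqVlt => /orP[/eqP ->|lt]; first by rewrite bal; lia.
  by have := leM _ lt; rewrite cntS; have := leq_b1 (ups p k./2); lia.
apply/bigmax_leqP => -[k km] _ /=.
have lt : k.*2.+1 < m.*2.+1 by lia.
have := leq_bigmax (F := fun k : 'I_(m.*2.+1) => `|level p k|%N) (Ordinal lt).
by rewrite -/(height p) /= level_odd //; have := dom k km; lia.
Qed.

(** At vertex k the difference is at most k+1, the number of possible starts, and at most m-k, the
    number of possible ends still to come. These bounds add up to m+1. *)
Lemma uphalf_height_le p : dyck_path p -> uphalf (height p) <= uphalf m.
Proof.
move=> dp; rewrite uphalf_height //; case/dyck_pathP: dp => dom bal.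
apply/bigmax_leqP => -[k km] _ /=.
have := cnt_subadd (ups p) (leq0n k.+1); rewrite cnt0.
have := cnt_subadd (downs p) (ltnW km); have := leq_cnt (ups p) km.
by lia.
Qed.

Lemma uphalf_height_gt0 p : 0 < m -> dyck_path p -> 0 < uphalf (height p).
Proof.
move=> m0 dp; rewrite uphalf_height //; case/dyck_pathP: dp => dom _.
have := leq_bigmax (F := fun k : 'I_m => cnt (ups p) k.+1 - cnt (downs p) k) (Ordinal m0).
by have := dom 0 m0; rewrite /=; lia.
Qed.

End Paths.

(** * The bijection between area sequences and Dyck paths *)

Section Encoding.

Variable n : nat.
Implicit Types (a : {ffun 'I_n -> 'I_n}) (p : n.*2.-tuple bool).

(* The value [i] beyond the last vertex makes [endb] hold at the last vertex. *)
Definition leftmost a i := if insub i is Some j then i - a j else i.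

Lemma leftmostE a (j : 'I_n) : leftmost a j = j - a j.
Proof. by rewrite /leftmost valK. Qed.

Lemma leftmost_le a i : leftmost a i <= i.
Proof. by rewrite /leftmost; case: insub => [j|//]; rewrite leq_subr. Qed.

Lemma leftmost_id a i : n <= i -> leftmost a i = i.
Proof. by move=> ni; rewrite /leftmost insubF // ltnNge ni. Qed.

(** For two vertices this is the condition that [a] grows by at most one per step. *)
Lemma leftmost_mono a i : a \in DP n -> leftmost a i <= leftmost a i.+1.
Proof.
rewrite inE => /andP[_ /forallP/(_ _)/forallP step].
case: (ltnP i.+1 n) => [lt|ge]; last first.
  by rewrite (leftmost_id _ ge) (leq_trans (leftmost_le _ _)).
have := step (Ordinal (ltnW lt)) (Ordinal lt); rewrite eqxx /=.
have := leftmostE a (Ordinal lt); have := leftmostE a (Ordinal (ltnW lt)) => /= -> ->.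
by lia.
Qed.

Definition encode a : n.*2.-tuple bool :=
  [tuple if odd i then ~~ endb (leftmost a) i./2 else startb n (leftmost a) i./2
     | i < n.*2].

Lemma nth_encode a k : k < n.*2 -> nth false (encode a) k =
  if odd k then ~~ endb (leftmost a) k./2 else startb n (leftmost a) k./2.
Proof. by move=> kn; rewrite -[k in LHS]/(val (Ordinal kn)) -tnth_nth tnth_mktuple. Qed.

Lemma ups_encode a i : i < n -> ups (encode a) i = startb n (leftmost a) i.
Proof.
by move=> lt; rewrite /ups nth_encode ?ltn_double // odd_double doubleK.
Qed.

Lemma downs_encode a i : i < n -> downs (encode a) i = endb (leftmost a) i.
Proof.
move=> lt; rewrite /downs nth_encode; last by lia.
by rewrite /= odd_double negbK uphalf_double.
Qed.

Lemma cnt_ups_encode a k : k <= n ->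
  cnt (ups (encode a)) k = cnt (startb n (leftmost a)) k.
Proof. by apply: eq_cnt => i; exact: ups_encode. Qed.

Lemma cnt_downs_encode a k : k <= n ->
  cnt (downs (encode a)) k = cnt (endb (leftmost a)) k.
Proof. by apply: eq_cnt => i; exact: downs_encode. Qed.

Lemma leq_leftmost_cnt a j v : a \in DP n -> j < n -> v < n ->
  (leftmost a j <= v) = (cnt (downs (encode a)) j < cnt (ups (encode a)) v.+1).
Proof.
move=> aDP jn vn; rewrite cnt_ups_encode // (cnt_downs_encode _ (ltnW jn)).
by apply: leq_b_cnt => // i; [exact: leftmost_le|exact: leftmost_mono|exact: leftmost_id].
Qed.

Lemma encode_dyck a : a \in DP n -> dyck_path (encode a).
Proof.
move=> aDP; apply/dyck_pathP; split=> [k kn|].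
  by rewrite -leq_leftmost_cnt // leftmost_le.
rewrite cnt_ups_encode // cnt_downs_encode //.
by apply: cnt_startb_endb => // i; [exact: leftmost_le|exact: leftmost_mono|exact: leftmost_id].
Qed.

Definition decode p : {ffun 'I_n -> 'I_n} :=
  [ffun j : 'I_n => Ordinal (leq_ltn_trans
     (leq_subr (lend n (ups p) (downs p) j) j) (ltn_ord j))].

Lemma decodeE p j : decode p j = j - lend n (ups p) (downs p) j :> nat.
Proof. by rewrite ffunE. Qed.

(** The rebuilt and the original left end have the same upper bounds v < n, by [leq_lend] and
    [leq_leftmost_cnt]; each is tested at the value of the other. *)
Lemma encodeK a : a \in DP n -> decode (encode a) = a.
Proof.
move=> aDP; apply/ffunP => j; apply: val_inj; rewrite /= decodeE.
suff -> : lend n (ups (encode a)) (downs (encode a)) j = leftmost a j.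
  rewrite leftmostE subKn //.
  by move: aDP; rewrite inE => /andP[/forallP/(_ j)].
have lt : leftmost a j < n by apply: leq_ltn_trans (leftmost_le _ _) _.
have le : lend n (ups (encode a)) (downs (encode a)) j <= leftmost a j.
  by rewrite leq_lend // -leq_leftmost_cnt.
have ltl := leq_ltn_trans le lt.
by apply/eqP; rewrite eqn_leq le leq_leftmost_cnt // -(leq_lend _ _ _ ltl) /=.
Qed.

Lemma decode_DP p : dyck_path p -> decode p \in DP n.
Proof.
case/dyck_pathP => dom bal; rewrite inE; apply/andP; split.
  by apply/forallP => i; rewrite decodeE leq_subr.
apply/forallP => i; apply/forallP => j; apply/implyP => /eqP ji.
by rewrite !decodeE ji; have := lend_mono n (ups p) (downs p) i; lia.
Qed.

(** The case i = n, where balance enters, serves the end letter of the last vertex. *)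
Lemma leftmost_decode p i : dyck_path p -> i <= n ->
  leftmost (decode p) i = lend n (ups p) (downs p) i.
Proof.
case/dyck_pathP => dom bal; rewrite leq_eqVlt => /orP[/eqP ->|lt].
  by rewrite leftmost_id // lend_n.
have /= -> := leftmostE (decode p) (Ordinal lt).
by rewrite decodeE /= subKn // lend_le.
Qed.

Lemma decodeK p : dyck_path p -> encode (decode p) = p.
Proof.
move=> dp; have /dyck_pathP[dom bal] := dp.
apply: val_inj; apply: (@eq_from_nth _ false); first by rewrite !size_tuple.
move=> k; rewrite size_tuple => kn; rewrite nth_encode //.
have hk : k./2 < n by lia.
have kE := odd_double_half k; case: ifP kE => _ kE.
  rewrite /endb (leftmost_decode dp (ltnW hk)) (leftmost_decode dp hk) lend_end //.
  by rewrite /downs negbK -[in RHS]kE add1n.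
rewrite -[in RHS]kE add0n -[nth _ _ _]/(ups p k./2) -(lend_start bal hk).
rewrite /startb; congr (_ \in _); apply/eq_in_map => j.
by rewrite mem_iota add0n => /= jn; rewrite (leftmost_decode dp (ltnW jn)).
Qed.

End Encoding.

(** * Peak-cliques and connectedness read off the path *)

Section Graph.

Variable n : nat.
Implicit Types (a : {ffun 'I_n -> 'I_n}) (p : n.*2.-tuple bool).

Lemma Gamma_lt a (i j : 'I_n) : i < j -> Gamma a i j = (leftmost a j <= i).
Proof. by move=> ij; rewrite /Gamma leftmostE ij ltnNge (ltnW ij). Qed.

Lemma Gamma_sym a i j : Gamma a i j = Gamma a j i.
Proof. by rewrite /Gamma orbC. Qed.

Lemma Gamma_irr a i : Gamma a i i = false.
Proof. by rewrite /Gamma ltnn. Qed.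

Lemma leftmost_homo a i j : a \in DP n -> i <= j -> leftmost a i <= leftmost a j.
Proof. by move=> aDP; apply: b_homo => k; exact: leftmost_mono. Qed.

(** An edge {i,j} cannot be moved left iff i is the leftmost neighbour of j, and cannot be moved
    right iff the left end of j+1 lies beyond i. Isolated vertices are the case
    [leftmost a j = j]. *)
Lemma peak_edge_Gamma a (i j : 'I_n) : a \in DP n ->
  peak_edge (Gamma a) i j = endb (leftmost a) j && (leftmost a j == i).
Proof.
move=> aDP; have lej := leftmost_le a j.
have lejS : leftmost a j.+1 <= j.+1 by exact: leftmost_le.
have mono := leftmost_mono (j : nat) aDP.
apply/orP/andP => [[/andP[/eqP -> /forallP iso]|]|].
- have lj : leftmost a j = j.
    apply/eqP; rewrite eqn_leq lej leqNgt; apply/negP => lt.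
    have ltn : leftmost a j < n by exact: leq_ltn_trans (ltn_ord j).
    have := iso (Ordinal ltn); rewrite Gamma_sym Gamma_lt //=.
    by rewrite leqnn.
  split; last by rewrite lj.
  rewrite /endb lj ltnNge; apply/negP => le.
  have jn : j.+1 < n.
    by rewrite ltnNge; apply/negP => /(leftmost_id a) E; rewrite E ltnn in le.
  by have := iso (Ordinal jn); rewrite Gamma_lt //= le.
- case/and4P => ij; rewrite Gamma_lt // => le /forallP right /forallP left.
  have -> : leftmost a j == i.
    rewrite eqn_leq le leqNgt; apply/negP => lt.
    have i1 : i.-1 < n by exact: leq_ltn_trans (leq_pred _) (ltn_ord i).
    have := left (Ordinal i1); rewrite Gamma_lt /=; last by lia.
    by rewrite prednK ?eqxx /=; lia.
  split=> //; rewrite /endb.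
  case: (ltnP j.+1 n) => [jn|/(leftmost_id a) ->]; last by lia.
  have := right (Ordinal jn); rewrite eqxx Gamma_lt /=; last by lia.
  by lia.
- rewrite /endb => -[lt /eqP li].
  case: (ltnP i j) => [ij|ji].
    right; apply/and4P; split => //; first by rewrite Gamma_lt // li.
      apply/forallP => k; apply/implyP => /eqP kj; rewrite Gamma_lt; last by lia.
      by rewrite kj -ltnNge -li.
    apply/forallP => k; apply/implyP => /eqP ki; rewrite Gamma_lt; last by lia.
    by rewrite -ltnNge li -ki.
  left; have ij : i = j by apply: val_inj => /=; lia.
  rewrite ij eqxx /=; apply/forallP => k; apply/negP.
  case: (ltngtP j k) => [jk|kj|/val_inj <-]; last by rewrite Gamma_irr.
    rewrite Gamma_lt // => le.
    by have := leftmost_homo aDP (jk : j.+1 <= k); move: li; rewrite ij; lia.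
  by rewrite Gamma_sym Gamma_lt // li ij; lia.
Qed.

Lemma peak_cliques_Gamma a : a \in DP n -> peak_cliques (Gamma a) =
  [set [set k : 'I_n | leftmost a j <= k <= j] | j : 'I_n & endb (leftmost a) j].
Proof.
move=> aDP; apply/setP => C; apply/imsetP/imsetP => [[[i j]]|[j]]; rewrite inE.
  rewrite peak_edge_Gamma //= => /andP[ej /eqP li] ->.
  by exists j; rewrite ?inE // li.
move=> ej ->; have lt : leftmost a j < n by exact: leq_ltn_trans (leftmost_le _ _) (ltn_ord j).
by exists (Ordinal lt, j) => //; rewrite inE peak_edge_Gamma //= ej eqxx.
Qed.

Lemma peak_nesting_Gamma a (v : 'I_n) : a \in DP n ->
  peak_nesting (Gamma a) v =
    cnt (ups (encode a)) v.+1 - cnt (downs (encode a)) v.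
Proof.
move=> aDP; rewrite cnt_ups_encode // cnt_downs_encode; last exact: ltnW.
rewrite -(sum_nesting (leftmost_le a)) //; last 2 first.
- by move=> i; exact: leftmost_mono.
- exact: leftmost_id.
pose I (j : 'I_n) := [set k : 'I_n | leftmost a j <= k <= j].
rewrite /peak_nesting peak_cliques_Gamma //.
transitivity #|I @: [set j : 'I_n | endb (leftmost a) j & leftmost a j <= v <= j]|.
  apply: eq_card => C; rewrite inE; apply/andP/imsetP => [[/imsetP[j]]|[j]].
    by rewrite inE => ej ->; rewrite inE => vj; exists j; rewrite ?inE ?ej.
  rewrite inE => /andP[ej vj] ->; split; last by rewrite inE.
  by apply/imsetP; exists j; rewrite ?inE.
rewrite card_imset; first by rewrite -sum1dep_card big_mkcond.
(* Distinct ends give distinct cliques: if two intervals coincide, each contains the right end of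
   the other. *)
move=> i j /setP E; apply: val_inj; apply/eqP; rewrite eqn_leq.
have := E i; have := E j; rewrite !inE !leqnn !leftmost_le /= => /andP[_ ->].
by move=> /esym/andP[_ ->].
Qed.

Lemma pnest_encode a : a \in DP n -> pnest a = uphalf (height (encode a)).
Proof.
move=> aDP; rewrite uphalf_height; last exact: encode_dyck.
by apply: eq_bigr => v _; exact: peak_nesting_Gamma.
Qed.

(** Levels vanish only at even times, so a Dyck path with this property meets the axis only at its
    two ends. *)
Definition prime_path p := [forall k : 'I_n, (0 < k) ==> (0 < level p k.*2)%R].

(** The level at time 2(k+1) is positive iff k and k+1 are adjacent. If all consecutive vertices
    are, the graph is connected; if k and k+1 are not, monotone left ends let no edge join {0,...,k}
    to the rest. *)
Lemma connected_encode a : a \in DP n ->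
  graph_connected (Gamma a) = prime_path (encode a).
Proof.
move=> aDP.
have levelE k : k.+1 < n -> (0 < level (encode a) k.+1.*2)%R = (leftmost a k.+1 <= k).
  move=> kn; rewrite leq_leftmost_cnt //; last exact: ltnW.
  by rewrite level_even; [lia|exact: ltnW].
apply/forallP/forallP => [conn [[|k] kn] //=|prime x].
  rewrite levelE // leqNgt; apply/negP => lt.
  have cl : closed (Gamma a) [pred x : 'I_n | x <= k].
    apply: intro_closed => [|x y]; first by apply: sym_connect_sym => x y; exact: Gamma_sym.
    rewrite !inE => Gxy xk; rewrite leqNgt; apply/negP => ky.
    move: Gxy; rewrite Gamma_lt; last by exact: leq_ltn_trans ky.
    by have := leftmost_homo aDP (ky : k.+1 <= y); lia.
  have := closed_connect cl (forallP (conn (Ordinal (ltnW kn))) (Ordinal kn)).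
  by rewrite !inE /= leqnn ltnn.
have csym : connect_sym (Gamma a) by apply: sym_connect_sym => i j; exact: Gamma_sym.
have up (k d : nat) (kn : k < n) (kdn : k + d < n) :
    connect (Gamma a) (Ordinal kn) (Ordinal kdn).
  elim: d kdn => [|d IH] kdn.
    by rewrite (_ : Ordinal kn = Ordinal kdn) //; apply: val_inj => /=; lia.
  have kdn' : k + d < n by lia.
  apply: connect_trans (IH kdn') (connect1 _).
  have kdS : (k + d).+1 < n by lia.
  rewrite Gamma_lt /=; last by lia.
  by have := prime (Ordinal kdS); rewrite /= levelE // addnS.
apply/forallP => y.
have upo (i j : 'I_n) : i <= j -> connect (Gamma a) i j.
  move=> ij; have jn : i + (j - i) < n by rewrite subnKC.
  have := up _ _ (ltn_ord i) jn.
  by congr connect; apply: val_inj => //=; rewrite subnKC.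
by case: (leqP x y) => [|/ltnW] /upo //; rewrite csym.
Qed.

Lemma sum_DP_dyck (R : nmodType) (P : pred (n.*2.-tuple bool)) (F : nat -> R) :
  (\sum_(a in DP n | P (encode a)) F (pnest a) =
   \sum_(p | dyck_path p && P p) F (uphalf (height p)))%R.
Proof.
rewrite (reindex_onto (@decode n) (@encode n)) => [|a /andP[aDP _]]; last exact: encodeK.
(* This is the form in which [reindex_onto] describes the image of the bijection. *)
have dyckE p : dyck_path p = (decode p \in DP n) && (encode (decode p) == p).
  apply/idP/andP => [dp|[dDP /eqP <-]]; first by rewrite decode_DP // decodeK.
  exact: encode_dyck.
apply: eq_big => [p|p /andP[/andP[dDP _] /eqP E]]; last by rewrite pnest_encode // E.
rewrite dyckE; case: eqP => [->|]; first by rewrite !andbT.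
by rewrite !andbF.
Qed.

End Graph.

(** * Paths U q D that meet the axis only at their ends *)

Section Primes.

Variable m : nat.
Implicit Types (p : m.+1.*2.-tuple bool) (q : m.*2.-tuple bool).

Definition elevate q : m.+1.*2.-tuple bool :=
  [tuple of true :: rcons q false].

Lemma elevate_inj : injective elevate.
Proof. by move=> q q' /(congr1 val) [] /rcons_inj[/val_inj]. Qed.

Lemma level_elevate q k : k <= m.*2 -> level (elevate q) k.+1 = (1 + level q k)%R.
Proof.
by move=> km; rewrite /level /= big_cons -cats1 takel_cat // size_tuple.
Qed.

Lemma level_elevate_full q : level (elevate q) m.+1.*2 = level q m.*2.
Proof.
have last0 : nth false (elevate q) m.*2.+1 = false.
  by rewrite -[LHS]/(nth false (rcons q false) m.*2) nth_rcons size_tuple ltnn eqxx.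
by rewrite doubleS levelS ?doubleS // last0 level_elevate //; lia.
Qed.

Lemma elevateP p : dyck_path p -> exists q, p = elevate q.
Proof.
case/andP => /forallP pos /eqP bal.
have p0 : nth false p 0.
  have := pos (Ordinal (isT : 1 < m.+1.*2.+1)).
  by rewrite /= levelS // /level take0 big_nil; case: (nth _ _ _).
have pl : nth false p m.*2.+1 = false.
  have lt : m.*2.+1 < m.+1.*2.+1 by lia.
  have : (0 <= level p m.*2.+1)%R by exact: pos (Ordinal lt).
  have : level p m.*2.+2 = 0%R := bal.
  rewrite levelS ?doubleS //.
  by case: (nth _ _ _) => //=; lia.
have sz : size (take m.*2 (behead p)) == m.*2.
  by rewrite size_takel // size_behead size_tuple; lia.
exists (Tuple sz); apply: val_inj => /=.
move: p0 pl (size_tuple p); case: (val p) => //= x s -> <- [ss].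
by rewrite -take_nth ?ss // take_oversize // ss.
Qed.

Lemma elevate_dyck q :
  dyck_path (elevate q) && prime_path (elevate q) = dyck_path q.
Proof.
apply/andP/idP => [[/andP[/forallP pos /eqP bal] /forallP prime]|/andP[/forallP pos /eqP bal]].
  apply/andP; split; last by rewrite -level_elevate_full bal.
  apply/forallP => -[k km] /=; have kE := odd_double_half k.
  have kS : k.+1 < m.+1.*2.+1 by lia.
  have := pos (Ordinal kS); rewrite /= level_elevate //.
  case: (boolP (odd k)) kE => /= ok kE.
    (* At odd k primality applies at the even time k+1 of the elevated path, where the level is
       therefore at least 1. *)
    have lt : k./2.+1 < m.+1 by lia.
    have := prime (Ordinal lt).
    have -> /= : k./2.+1.*2 = k.+1 by lia.
    by rewrite level_elevate //; lia.
  (* At even k the level of q is even and at least -1, hence nonnegative. *)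
  have le : k./2 <= m by lia.
  by rewrite -kE add0n level_even //; lia.
have pos' k : k <= m.*2 -> (0 <= level q k)%R.
  by move=> km; exact: (pos (Ordinal (km : k < m.*2.+1))).
split; last first.
  apply/forallP => k; apply/implyP => k_gt0; have km := ltn_ord k.
  have -> : k.*2 = k.*2.-1.+1 by lia.
  by rewrite level_elevate; [have := pos' k.*2.-1|]; lia.
apply/andP; split; last by rewrite level_elevate_full bal.
apply/forallP => -[[|k] km] /=; first by rewrite /level take0 big_nil.
have : k.+1 <= m.+1.*2 by lia.
rewrite leq_eqVlt => /orP[/eqP ->|lt]; first by rewrite level_elevate_full bal.
rewrite level_elevate; last by lia.
by have := pos' k; lia.
Qed.

Lemma height_elevate q : dyck_path q -> height (elevate q) = (height q).+1.
Proof.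
case/andP => /forallP pos /eqP bal.
have pos' k : k <= m.*2 -> (0 <= level q k)%R.
  by move=> km; exact: (pos (Ordinal (km : k < m.*2.+1))).
apply/eqP; rewrite eqn_leq; apply/andP; split.
  apply/bigmax_leqP => -[[|k] km] _ /=; first by rewrite /level take0 big_nil.
  have : k.+1 <= m.+1.*2 by lia.
  rewrite leq_eqVlt => /orP[/eqP ->|lt]; first by rewrite level_elevate_full bal.
  have kq : k < m.*2.+1 by lia.
  have := leq_bigmax (F := fun k : 'I_(m.*2.+1) => `|level q k|%N) (Ordinal kq).
  by rewrite -/(height q) /= level_elevate //; lia.
rewrite /height; have [|[k km] /= ->] := @eq_bigmax _ (fun k : 'I_(m.*2.+1) => `|level q k|%N).
  by rewrite card_ord.
have kp : k.+1 < m.+1.*2.+1 by lia.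
apply: leq_trans (leq_bigmax (F := fun k : 'I_(m.+1.*2.+1) => `|level (elevate q) k|%N) (Ordinal kp)).
by rewrite /= level_elevate //; have := pos' k; lia.
Qed.

Lemma card_prime_height k :
  #|[set p : m.+1.*2.-tuple bool | dyck_path p && prime_path p & height p == k.+1]| =
  H m k.
Proof.
rewrite /H -(card_imset _ elevate_inj); apply: eq_card => p; rewrite !inE.
apply/andP/imsetP => [[/andP[dp pp] hp]|[q]].
  have [q pq] := elevateP dp; exists q => //; rewrite inE.
  have dq : dyck_path q by rewrite -elevate_dyck -pq dp pp.
  by move: hp; rewrite dq pq height_elevate.
rewrite inE => /andP[dq /eqP hq] ->.
by rewrite elevate_dyck height_elevate // hq.
Qed.

End Primes.

(** * Collecting equal exponents, and the two formulas *)

Lemma sum_polyXn_card (T : finType) (P : pred T) (w : T -> nat) K :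
  (forall x, P x -> 0 < w x < K) ->
  (\sum_(x | P x) 'X^(w x) =
   \sum_(1 <= i < K) #|[set x | P x & w x == i]|%:R *: 'X^i :> {poly int})%R.
Proof.
move=> wK; transitivity (\sum_(x | P x) \sum_(1 <= i < K | i == w x) 'X^i : {poly int})%R.
  by apply: eq_bigr => x /wK xK; rewrite big_nat1_eq xK.
rewrite (exchange_big_dep predT) //=; apply: eq_bigr => i _.
rewrite sumr_const scaler_nat; congr (_ *+ _)%R; apply: eq_card => x.
by rewrite !inE eq_sym.
Qed.

(** Rounding up half of h gives i exactly for h = 2i-1 and h = 2i; at i = 0 truncated subtraction
    would count h = 0 twice. *)
Lemma card_uphalf_height (T : finType) (P : pred T) (h : T -> nat) i : 0 < i ->
  #|[set x | P x & uphalf (h x) == i]| =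
  #|[set x | P x & h x == 2 * i - 1]| + #|[set x | P x & h x == 2 * i]|.
Proof.
move=> i0; rewrite -!sum1dep_card !(big_mkcond (fun x => P x && _)) -big_split /=.
by apply: eq_bigr => x _; case: (P x) => //=; do 3!case: eqP => ? //=; lia.
Qed.

Unset Implicit Arguments.

Theorem corollary3p13 (n : nat) (hn : 1 <= n) :
  Pnest n =
    (\sum_(1 <= i < (uphalf n).+1)
       (H n (2 * i - 1) + H n (2 * i))%N%:R *: 'X^i)%R
  /\
  Pnest_c n =
    (\sum_(1 <= i < (uphalf n).+1)
       (H n.-1 (2 * i - 2) + H n.-1 (2 * i - 1))%N%:R *: 'X^i)%R.
Proof.
have bounds p : dyck_path p -> 0 < uphalf (@height n p) < (uphalf n).+1.
  by move=> dp; rewrite uphalf_height_gt0 // ltnS uphalf_height_le.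
split.
  transitivity (\sum_(p | @dyck_path n p) 'X^(uphalf (height p)) : {poly int})%R.
    have := sum_DP_dyck predT (fun k => 'X^k : {poly int})%R (n := n).
    by under eq_bigl do rewrite andbT; under [RHS]eq_bigl do rewrite andbT.
  rewrite (sum_polyXn_card bounds); apply: eq_big_nat => i /andP[i0 _].
  by rewrite card_uphalf_height.
case: n hn bounds => // m _ bounds.
transitivity (\sum_(p | @dyck_path m.+1 p && prime_path p)
    'X^(uphalf (height p)) : {poly int})%R.
  rewrite -(sum_DP_dyck (@prime_path _) (fun k => 'X^k : {poly int})%R).
  by apply: eq_bigl => a; case: (boolP (a \in DP _)) => //= /connected_encode ->.
rewrite (sum_polyXn_card (K := (uphalf m.+1).+1)) => [|p /andP[/bounds]] //.
apply: eq_big_nat => i /andP[i0 _]; rewrite card_uphalf_height //.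
(* Both heights are put in successor form so that [card_prime_height] lowers them to 2i-2 and
   2i-1. *)
have -> : 2 * i - 1 = (2 * i - 2).+1 by lia.
have -> : 2 * i = (2 * i - 2).+2 by lia.
by rewrite !card_prime_height /= subn2.
Qed.
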